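(* Let $\gamma$ be a smooth closed curve in $2\Delta$ which starts at (and ends at) the point $\frac12$ and does not pass through any vertex of $2\Delta$. Then $\gamma$ is a primitive closed geodesic parametrized by a constant multiple of arc-length if and only if, up to rescaling of the parameter, $\gamma$ is given by $\gamma(t)=\pi\left(\frac12+t\omega_0\right)$ for some $\omega_0=m+n\omega$ with $m,n\in\mathbb{Z}$ relatively prime and $n$ odd, where $t\in[0,1]$ if $\omega_0\in Hex$ and $t\in[0,3]$ if $\omega_0\notin Hex$.
   Context: Let $\omega=\exp(2\pi i/6)$ and $\Lambda_{1,\omega}=\mathbb{Z}+\mathbb{Z}\omega\subset\mathbb{C}$. Let $\Delta$ be the Euclidean equilateral triangle with vertices $0,1,\omega$, decorated with the symbols $\circ,\bullet,\ast$ respectively. $2\Delta$ is the sphere obtained by gluing $\Delta$ and its reflection $\bar\Delta$ in the real axis along their boundaries via $z\mapsto\bar z$, with its flat metric with conic singularities at the three vertices; $\frac12\in 2\Delta$ is the midpoint of the edge from $0$ to $1$. Let $\Gamma_{3,3,3}$ be the group of orientation-preserving isometries of $\mathbb{C}$ generated by the rotations of angle $2\pi/3$ about $0,1,\omega$; then $2\Delta=\mathbb{C}/\Gamma_{3,3,3}$, and $\pi:\mathbb{C}\to 2\Delta$ is the natural projection. The associated tessellation of $\mathbb{C}$ is by unit equilateral triangles with vertex set $\Lambda_{1,\omega}$, decorated $\Gamma_{3,3,3}$-invariantly and compatibly with $\Delta$; $Hex$ is the sub-lattice of vertices decorated $\circ$, equivalently the lattice of translations in $\Gamma_{3,3,3}$;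 $Hex=\langle 2-\omega,\,1+\omega\rangle$. A closed geodesic in $2\Delta$ is a smooth closed curve not passing through the vertices which is locally geodesic for the flat metric (including at the closing point). It is primitive if it is not a proper multiple (iterate) of a shorter closed geodesic. *)

(* Defs.v *)
(* Stdlib world: concrete reals, with Coquelicot (complex numbers, suprema in
   [Rbar], iterated derivatives, finite sums). *)
From Stdlib Require Import Reals ZArith Znumtheory.
From Coquelicot Require Import Coquelicot.

Open Scope R_scope.

Definition cis (theta : R) : C := (cos theta, sin theta).

Definition omega : C := cis (2 * PI / 6).

Definition lattice_point (m n : Z) : C :=
  (RtoC (IZR m) + RtoC (IZR n) * omega)%C.

Definition rotation (p : C) (theta : R) (z : C) : C :=
  (p + cis theta * (z - p))%C.

Definition Delta_vertex (p : C) : Prop :=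
  p = RtoC 0 \/ p = RtoC 1 \/ p = omega.

(* The subgroup of the isometries of the plane generated by the rotations of
   angle 2 pi / 3 about the three vertices of Delta. *)
Inductive Gamma333 : (C -> C) -> Prop :=
| Gamma_rot : forall p, Delta_vertex p -> Gamma333 (rotation p (2 * PI / 3))
| Gamma_id : Gamma333 (fun z => z)
| Gamma_comp : forall g h,
    Gamma333 g -> Gamma333 h -> Gamma333 (fun z => g (h z))
| Gamma_inv : forall g h,
    Gamma333 g -> (forall z, h (g z) = z) -> (forall z, g (h z) = z) ->
    Gamma333 h.

Definition orbit (z : C) : C -> Prop :=
  fun w => exists g, Gamma333 g /\ g z = w.

(* The doubled triangle 2 Delta, as the orbit space of Gamma333. *)
Definition DoubleDelta : Type := {A : C -> Prop | exists z, A = orbit z}.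

Definition proj (z : C) : DoubleDelta :=
  exist _ (orbit z) (ex_intro _ z eq_refl).

(* Flat metric: Gamma333 acts by isometries, and the distance of the quotient
   is the distance between orbits.  The infimum is over a nonempty set of
   nonnegative numbers, hence finite. *)
Definition dist2 (x y : DoubleDelta) : R :=
  real (Glb_Rbar (fun r => exists z w : C,
    proj z = x /\ proj w = y /\ r = Cmod (z - w)%C)).

(* The vertices of the tessellation carrying the symbol of the vertex 0 of
   Delta: the decoration is Gamma333-invariant, and the three vertices of Delta
   lie in distinct orbits. *)
Definition Hex (z : C) : Prop := proj z = proj (RtoC 0).

Definition avoids_vertices (gamma : R -> DoubleDelta) : Prop :=
  forall t p, Delta_vertex p -> gamma t <> proj p.

(* Off the vertices the charts of 2 Delta are the local inverses of [proj], so
   smoothness amounts to the existence of smooth local lifts to C.  This is the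
   right notion only for curves that avoid the vertices. *)
Definition smooth_curve (gamma : R -> DoubleDelta) : Prop :=
  forall t, exists (eps : R) (f : R -> C), 0 < eps /\
    forall s, Rabs (s - t) < eps ->
      gamma s = proj (f s) /\
      forall n, ex_derive_n (fun u => fst (f u)) n s /\
                ex_derive_n (fun u => snd (f u)) n s.

(* A closed curve parametrized by [0,T] is encoded by its T-periodic extension
   to R, i.e. as a map on the circle R / TZ; conditions imposed at every real
   parameter therefore include the closing point. *)
Definition smooth_closed_curve (T : R) (gamma : R -> DoubleDelta) : Prop :=
  0 < T /\ (forall t, gamma (t + T) = gamma t) /\ smooth_curve gamma.

Definition arc_length (gamma : R -> DoubleDelta) (a b : R) : Rbar :=
  Lub_Rbar (fun l => exists (n : nat) (sigma : nat -> R),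
    sigma O = a /\ sigma (S n) = b /\
    (forall i, (i <= n)%nat -> sigma i <= sigma (S i)) /\
    l = sum_n (fun i => dist2 (gamma (sigma i)) (gamma (sigma (S i)))) n).

(* Locally length-minimizing, with no constraint on the parametrization. *)
Definition locally_geodesic (gamma : R -> DoubleDelta) : Prop :=
  forall t, exists eps, 0 < eps /\
    forall a b, t - eps < a -> a <= b -> b < t + eps ->
      arc_length gamma a b = Finite (dist2 (gamma a) (gamma b)).

Definition closed_geodesic (T : R) (gamma : R -> DoubleDelta) : Prop :=
  smooth_closed_curve T gamma /\
  avoids_vertices gamma /\
  (exists t, gamma t <> gamma 0) /\
  locally_geodesic gamma.

(* [gamma] on [0,T] traverses k times the closed curve [delta] of period S, up
   to an orientation-preserving change of parameter. *)
Definition iterate_of (k : nat) (S : R) (delta : R -> DoubleDelta)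
    (T : R) (gamma : R -> DoubleDelta) : Prop :=
  exists phi : R -> R,
    (forall t, continuous phi t) /\
    (forall s t, s < t -> phi s < phi t) /\
    phi 0 = 0 /\ phi T = INR k * S /\
    (forall t, 0 <= t <= T -> gamma t = delta (phi t)).

Definition primitive_closed_geodesic (T : R) (gamma : R -> DoubleDelta) : Prop :=
  closed_geodesic T gamma /\
  ~ (exists (k : nat) (S : R) (delta : R -> DoubleDelta),
       (2 <= k)%nat /\ closed_geodesic S delta /\
       iterate_of k S delta T gamma).

Definition proportional_to_arc_length (gamma : R -> DoubleDelta) : Prop :=
  exists c, 0 < c /\
    forall a b, a <= b -> arc_length gamma a b = Finite (c * (b - a)).

(* The curve [gamma] on [0,T] is [gamma0] on [0,T0] after a linear rescaling of
   the parameter. *)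
Definition rescaling_of (T0 : R) (gamma0 : R -> DoubleDelta)
    (T : R) (gamma : R -> DoubleDelta) : Prop :=
  exists c, 0 < c /\ c * T = T0 /\
    forall t, 0 <= t <= T -> gamma t = gamma0 (c * t).

Definition straight_curve (w : C) (t : R) : DoubleDelta :=
  proj (RtoC (1 / 2) + RtoC t * w)%C.

(* Main.v *)
(* Every element of [Gamma333] has the form [z |-> u z + h] with [u] a cube root of
   unity and [h] in the sublattice [m = n mod 3], so points away from the lattice are
   moved by a definite amount and the projection is isometric on small discs around
   them.  A geodesic of constant speed therefore lifts locally, and by continuation
   globally, to a straight line [1/2 + t v]; closing up after time [T] with the same
   direction means that [T v] is a translation of the group, and dividing by the gcd
   gives the coprime direction.  Missing the vertices is the parity condition on [n],
   and primitivity selects the first multiple of [m + n omega] lying in the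
   translation lattice. *)
Require Import Defs.
From Stdlib Require Import Reals ZArith Znumtheory.
From Coquelicot Require Import Coquelicot.
From Stdlib Require Import Lra Lia Classical ProofIrrelevance.
From Stdlib Require Import FunctionalExtensionality PropExtensionality.
Open Scope R_scope.

(** * The group and its orbits *)

(** Near a cone point the projection is not isometric, so comparisons between the plane and the
    quotient are made inside discs whose radius is a fixed fraction of the distance to the lattice.
    The main obstacle is that the group contains rotations: returning to the starting point does not
    mean returning with the same direction. Hence closing is tested on a second point further along
    the line, which pins down the linear part [u] of the group element; a cube root of unity that is
    a positive real can only be 1. The periods 1 and 3 come from arithmetic: for coprime [m], [n], a
    multiple of [m + n omega] is a translation exactly when the factor is an integer [k] with 3
    dividing [k (m - n)]. *)

Definition zeta : C := cis (2 * PI / 3).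

Lemma omega_eq : omega = (1 / 2, sqrt 3 / 2).
Proof.
  unfold omega, cis. replace (2 * PI / 6) with (PI / 3) by field.
  now rewrite cos_PI3, sin_PI3.
Qed.

Lemma zeta_eq : zeta = (omega - 1)%C.
Proof.
  rewrite omega_eq. unfold zeta, cis.
  replace (2 * PI / 3) with (2 * (PI / 3)) by field.
  rewrite cos_2PI3, sin_2PI3.
  apply injective_projections; simpl; field.
Qed.

Lemma omega_sqr : (omega * omega)%C = (omega - 1)%C.
Proof.
  rewrite omega_eq. pose proof (sqrt_sqrt 3 ltac:(lra)) as H.
  apply injective_projections; simpl; nra.
Qed.

Lemma zeta_cube : (zeta * (zeta * zeta))%C = 1%C.
Proof.
  rewrite zeta_eq.
  replace ((omega - 1) * ((omega - 1) * (omega - 1)))%C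
    with (omega * (omega * omega) - 3 * (omega * omega) + 3 * omega - 1)%C by ring.
  rewrite omega_sqr.
  replace (omega * (omega - 1))%C with (omega * omega - omega)%C by ring.
  rewrite omega_sqr. ring.
Qed.

(** [lattice_point] with real coefficients. In this basis multiplication by [zeta] is an integer
    matrix and the squared modulus is the form [x^2 + x y + y^2]. *)
Definition coord (x y : R) : C := (RtoC x + RtoC y * omega)%C.

Lemma coord_pair (x y : R) : coord x y = (x + y / 2, y * (sqrt 3 / 2)).
Proof.
  unfold coord. rewrite omega_eq. apply injective_projections; simpl; field.
Qed.

Lemma coord_surj (z : C) : exists x y, z = coord x y.
Proof.
  pose proof (sqrt_lt_R0 3 ltac:(lra)) as H.
  exists (fst z - snd z / sqrt 3), (2 * snd z / sqrt 3).
  rewrite coord_pair. apply injective_projections; simpl; field; lra.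
Qed.

Lemma coord_inj (x y x' y' : R) : coord x y = coord x' y' -> x = x' /\ y = y'.
Proof.
  rewrite !coord_pair. intros H. pose proof (sqrt_lt_R0 3 ltac:(lra)) as H3.
  injection H as H1 H2.
  apply Rmult_eq_reg_r in H2; [split; lra | lra].
Qed.

Lemma coord_minus (x y x' y' : R) :
  (coord x y - coord x' y')%C = coord (x - x') (y - y').
Proof. unfold coord. rewrite !RtoC_minus. ring. Qed.

Lemma coord_plus (x y x' y' : R) :
  (coord x y + coord x' y')%C = coord (x + x') (y + y').
Proof. unfold coord. rewrite !RtoC_plus. ring. Qed.

Lemma coord_scal (t x y : R) : (RtoC t * coord x y)%C = coord (t * x) (t * y).
Proof. unfold coord. rewrite !RtoC_mult. ring. Qed.

Lemma zeta_coord (x y : R) : (zeta * coord x y)%C = coord (- x - y) x.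
Proof.
  rewrite zeta_eq. unfold coord. rewrite RtoC_minus, RtoC_opp.
  replace ((omega - 1) * (x + y * omega))%C
    with (x * omega + y * (omega * omega) - x - y * omega)%C by ring.
  rewrite omega_sqr. ring.
Qed.

Lemma Cmod_coord (x y : R) : Cmod (coord x y) = sqrt (x * x + x * y + y * y).
Proof.
  rewrite coord_pair. unfold Cmod. simpl. f_equal.
  pose proof (sqrt_sqrt 3 ltac:(lra)). nra.
Qed.

Lemma Cmod_coord_ge_l (x y : R) : Rabs x / 2 <= Cmod (coord x y).
Proof.
  rewrite Cmod_coord. replace (Rabs x / 2) with (Rabs (x / 2)).
  - rewrite <- sqrt_Rsqr_abs. apply sqrt_le_1_alt. unfold Rsqr.
    pose proof (Rle_0_sqr x). pose proof (Rle_0_sqr (x / 2 + y)).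
    unfold Rsqr in *. nra.
  - unfold Rdiv. now rewrite Rabs_mult, (Rabs_pos_eq (/ 2)) by lra.
Qed.

Lemma Cmod_coord_ge_r (x y : R) : Rabs y / 2 <= Cmod (coord x y).
Proof.
  replace (Cmod (coord x y)) with (Cmod (coord y x)).
  - apply Cmod_coord_ge_l.
  - rewrite !Cmod_coord. f_equal. ring.
Qed.

Definition rot_unit (u : C) : Prop := u = 1%C \/ u = zeta \/ u = (zeta * zeta)%C.

(** The lattice [Hex] in purely arithmetic form, the condition [m = n] mod 3 being solved by
    [m = b + 3 a]; its agreement with the orbit of 0 is [Hex_lattice_point]. *)
Definition hex_vec (h : C) : Prop := exists a b : Z, h = lattice_point (b + 3 * a) b.

Lemma rot_unit_mult (u v : C) : rot_unit u -> rot_unit v -> rot_unit (u * v)%C.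
Proof.
  pose proof zeta_cube as H3. unfold rot_unit.
  intros [-> | [-> | ->]] [-> | [-> | ->]].
  - left. ring.
  - right; left. ring.
  - right; right. ring.
  - right; left. ring.
  - now right; right.
  - now left.
  - right; right. ring.
  - left. rewrite <- H3. ring.
  - right; left. replace (zeta * zeta * (zeta * zeta))%C
      with (zeta * (zeta * (zeta * zeta)))%C by ring. rewrite H3. ring.
Qed.

Lemma rot_unit_inv (u : C) : rot_unit u -> exists v, rot_unit v /\ (v * u)%C = 1%C.
Proof.
  pose proof zeta_cube as H3.
  intros [-> | [-> | ->]].
  - exists (RtoC 1). split; [now left | ring].
  - exists (zeta * zeta)%C. split; [now right; right |]. rewrite <- H3. ring.
  - exists zeta. split; [now right; left |]. exact H3.
Qed.

Lemma Cmod_zeta : Cmod zeta = 1.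
Proof.
  unfold zeta, cis, Cmod. simpl.
  transitivity (sqrt 1); [f_equal | apply sqrt_1].
  pose proof (sin2_cos2 (2 * PI / 3)) as H. unfold Rsqr in H. lra.
Qed.

Lemma Cmod_rot_unit (u : C) : rot_unit u -> Cmod u = 1.
Proof.
  intros [-> | [-> | ->]].
  - apply Cmod_1.
  - apply Cmod_zeta.
  - rewrite Cmod_mult, Cmod_zeta. ring.
Qed.

Lemma lattice_point_coord (m n : Z) : lattice_point m n = coord (IZR m) (IZR n).
Proof. reflexivity. Qed.

Lemma hex_vec_0 : hex_vec 0%C.
Proof. exists 0%Z, 0%Z. unfold lattice_point. simpl. ring. Qed.

Lemma hex_vec_plus (h k : C) : hex_vec h -> hex_vec k -> hex_vec (h + k)%C.
Proof.
  intros [a [b ->]] [a' [b' ->]]. exists (a + a')%Z, (b + b')%Z.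
  rewrite !lattice_point_coord, coord_plus, <- !plus_IZR. f_equal; f_equal; ring.
Qed.

Lemma hex_vec_opp (h : C) : hex_vec h -> hex_vec (- h)%C.
Proof.
  intros [a [b ->]]. exists (- a)%Z, (- b)%Z.
  replace (- lattice_point (b + 3 * a) b)%C
    with (RtoC (-1) * lattice_point (b + 3 * a) b)%C
    by (change (-1)%R with (- (1))%R; rewrite RtoC_opp; ring).
  rewrite !lattice_point_coord, coord_scal, <- !mult_IZR. f_equal; f_equal; ring.
Qed.

Lemma hex_vec_rot (u h : C) : rot_unit u -> hex_vec h -> hex_vec (u * h)%C.
Proof.
  assert (Hz : forall k, hex_vec k -> hex_vec (zeta * k)%C).
  { intros k [a [b ->]]. exists (- b - 2 * a)%Z, (b + 3 * a)%Z.
    rewrite !lattice_point_coord, zeta_coord, <- opp_IZR, <- minus_IZR.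
    f_equal; f_equal; ring. }
  intros [-> | [-> | ->]] Hh.
  - now replace (1 * h)%C with h by ring.
  - auto.
  - rewrite <- Cmult_assoc. auto.
Qed.

(** The rotation about [p] is [zeta z + (1 - zeta) p], and [1 - zeta = 2 - omega] sends 0, 1,
    [omega] into the lattice of [hex_vec]. That lattice is stable under [zeta], so the form survives
    composition and inversion. *)
Lemma Gamma333_normal_form (g : C -> C) : Gamma333 g ->
  exists u h, rot_unit u /\ hex_vec h /\ forall z, g z = (u * z + h)%C.
Proof.
  induction 1 as [p Hp | | g k Hg [u [h [Hu [Hh E]]]] Hk [u' [h' [Hu' [Hh' E']]]]
                 | g k Hg [u [h [Hu [Hh E]]]] Hkg Hgk].
  - exists zeta, ((1 - zeta) * p)%C. split; [now right; left |]. split.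
    + destruct Hp as [-> | [-> | ->]].
      * replace ((1 - zeta) * 0)%C with (RtoC 0) by ring. apply hex_vec_0.
      * exists 1%Z, (-1)%Z. rewrite zeta_eq.
        transitivity (coord (1 + 1) (- (1))); [| rewrite lattice_point_coord; f_equal; ring].
        unfold coord. rewrite RtoC_plus, RtoC_opp. ring.
      * exists 0%Z, 1%Z. rewrite zeta_eq. unfold lattice_point. simpl (IZR _).
        replace ((1 - (omega - 1)) * omega)%C
          with (omega + omega - omega * omega)%C by ring.
        rewrite omega_sqr. ring.
    + intros z. unfold rotation. fold zeta. ring.
  - exists (RtoC 1), (RtoC 0). split; [now left |]. split; [apply hex_vec_0 |]. intros z. ring.
  - exists (u * u')%C, (u * h' + h)%C. split; [now apply rot_unit_mult |]. split.
    + apply hex_vec_plus; [now apply hex_vec_rot | easy].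
    + intros z. rewrite E, E'. ring.
  - destruct (rot_unit_inv u Hu) as [v [Hv Ev]].
    exists v, (- (v * h))%C. split; [easy |]. split.
    + now apply hex_vec_opp, hex_vec_rot.
    + intros z. rewrite <- (Hgk z) at 2. rewrite E.
      replace (v * (u * k z + h) + - (v * h))%C with (v * u * k z)%C by ring.
      rewrite Ev. ring.
Qed.

Lemma Gamma333_isometry (g : C -> C) (z w : C) :
  Gamma333 g -> Cmod (g z - g w)%C = Cmod (z - w)%C.
Proof.
  intros Hg. destruct (Gamma333_normal_form g Hg) as [u [h [Hu [_ E]]]].
  rewrite !E. replace (u * z + h - (u * w + h))%C with (u * (z - w))%C by ring.
  rewrite Cmod_mult, (Cmod_rot_unit u Hu). ring.
Qed.

Lemma Gamma333_inverse (g : C -> C) : Gamma333 g ->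
  exists k, Gamma333 k /\ (forall z, k (g z) = z) /\ (forall z, g (k z) = z).
Proof.
  intros Hg. destruct (Gamma333_normal_form g Hg) as [u [h [Hu [_ E]]]].
  destruct (rot_unit_inv u Hu) as [v [Hv Ev]].
  assert (H1 : forall z, (v * (g z - h))%C = z).
  { intros z. rewrite E. replace (v * (u * z + h - h))%C with (v * u * z)%C by ring.
    rewrite Ev. ring. }
  assert (H2 : forall z, g (v * (z - h))%C = z).
  { intros z. rewrite E.
    replace (u * (v * (z - h)) + h)%C with (v * u * (z - h) + h)%C by ring.
    rewrite Ev. ring. }
  exists (fun z => v * (z - h))%C. split; [| easy].
  now apply (Gamma_inv g).
Qed.

Lemma orbit_refl (z : C) : orbit z z.
Proof. exists (fun z => z). split; [constructor | easy]. Qed.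

Lemma orbit_sym (z w : C) : orbit z w -> orbit w z.
Proof.
  intros [g [Hg <-]]. destruct (Gamma333_inverse g Hg) as [k [Hk [E _]]].
  now exists k.
Qed.

Lemma orbit_trans (x y z : C) : orbit x y -> orbit y z -> orbit x z.
Proof.
  intros [g [Hg <-]] [k [Hk <-]]. exists (fun w => k (g w)).
  split; [now apply Gamma_comp | easy].
Qed.

Lemma proj_eq_iff (z w : C) : proj z = proj w <-> orbit z w.
Proof.
  split.
  - intros H. apply (f_equal (@proj1_sig _ _)) in H. simpl in H.
    rewrite H. apply orbit_refl.
  - intros H. unfold proj. apply subset_eq_compat.
    apply functional_extensionality. intros x.
    apply propositional_extensionality. split; intros Hx.
    + apply orbit_trans with z; [now apply orbit_sym | easy].
    + now apply orbit_trans with w.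
Qed.

Lemma proj_Gamma333 (g : C -> C) (z : C) : Gamma333 g -> proj (g z) = proj z.
Proof. intros Hg. symmetry. apply proj_eq_iff. now exists g. Qed.

Lemma orbit_rotation (p z : C) :
  Delta_vertex p -> orbit z (zeta * z + (1 - zeta) * p)%C.
Proof.
  intros Hp. exists (rotation p (2 * PI / 3)). split; [now constructor |].
  unfold rotation. fold zeta. ring.
Qed.

(** Undoing the rotation about 0 and then rotating about [p] is the translation by [(1 - zeta) p].
    The cases [p = 1] and [p = omega] give [2 - omega] and [1 + omega], which generate the
    lattice. *)
Lemma proj_translate (z h : C) : hex_vec h -> proj (z + h)%C = proj z.
Proof.
  assert (Hgen : forall p y, Delta_vertex p -> proj (y + (1 - zeta) * p)%C = proj y).
  { intros p y Hp. pose (x := (zeta * zeta * y)%C).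
    assert (Hx : (zeta * x)%C = y).
    { unfold x. replace (zeta * (zeta * zeta * y))%C
        with (zeta * (zeta * zeta) * y)%C by ring. rewrite zeta_cube. ring. }
    pose proof (orbit_rotation p x Hp) as Hp'.
    pose proof (orbit_rotation 0 x ltac:(now left)) as H0.
    rewrite Hx in Hp', H0. replace (y + (1 - zeta) * 0)%C with y in H0 by ring.
    apply proj_eq_iff, orbit_trans with x; [now apply orbit_sym | easy]. }
  assert (Hmul : forall e, (forall y, proj (y + e)%C = proj y) ->
             forall (k : Z) y, proj (y + RtoC (IZR k) * e)%C = proj y).
  { intros e He k. induction k as [| k IH | k IH] using Z.peano_ind; intros y.
    - f_equal. ring.
    - rewrite succ_IZR, RtoC_plus.
      replace (y + (IZR k + 1) * e)%C with (y + IZR k * e + e)%C by ring.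
      rewrite He. apply IH.
    - rewrite <- Z.sub_1_r, minus_IZR, RtoC_minus.
      rewrite <- (He (y + (IZR k - 1) * e)%C).
      replace (y + (IZR k - 1) * e + e)%C with (y + IZR k * e)%C by ring.
      apply IH. }
  intros [a [b ->]].
  assert (E : lattice_point (b + 3 * a) b
     = (RtoC (IZR a) * ((1 - zeta) * 1) + RtoC (IZR (a + b)) * ((1 - zeta) * omega))%C).
  { rewrite zeta_eq.
    replace ((1 - (omega - 1)) * omega)%C
          with (omega + omega - omega * omega)%C by ring.
    rewrite omega_sqr. unfold lattice_point.
    rewrite !plus_IZR, mult_IZR, !RtoC_plus, RtoC_mult.
    replace (RtoC 3) with (1 + 1 + 1)%C; [ring |].
    rewrite <- !RtoC_plus. f_equal. ring. }
  rewrite E, Cplus_assoc, !Hmul; [easy | |]; intros y; apply Hgen.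
  - now right; left.
  - now right; right.
Qed.

Lemma hex_vec_lattice_point (m n : Z) :
  hex_vec (lattice_point m n) <-> (3 | m - n)%Z.
Proof.
  split.
  - intros [a [b E]]. rewrite !lattice_point_coord in E.
    apply coord_inj in E. destruct E as [E1 E2].
    apply eq_IZR in E1, E2. exists a. lia.
  - intros [a Ha]. exists a, n. f_equal. lia.
Qed.

Lemma Hex_lattice_point (m n : Z) : Hex (lattice_point m n) <-> (3 | m - n)%Z.
Proof.
  rewrite <- hex_vec_lattice_point. unfold Hex. split.
  - intros H. symmetry in H. apply proj_eq_iff in H. destruct H as [g [Hg E]].
    destruct (Gamma333_normal_form g Hg) as [u [h [_ [Hh F]]]].
    rewrite F in E. rewrite <- E.
    now replace (u * 0 + h)%C with h by ring.
  - intros H. rewrite <- (proj_translate 0 _ H). f_equal. ring.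
Qed.

(** The residue of [m - n] mod 3 is the decoration: 0, 1 and 2 correspond to the vertices 0, 1 and
    [omega]. *)
Lemma proj_lattice_point (m n : Z) :
  exists p, Delta_vertex p /\ proj (lattice_point m n) = proj p.
Proof.
  assert (H : forall p q, (exists k, hex_vec k /\ p = (q + k)%C) -> proj p = proj q).
  { intros p q [k [Hk ->]]. now apply proj_translate. }
  pose proof (Z.mod_pos_bound (m - n) 3 ltac:(lia)) as Hb.
  pose proof (Z.div_mod (m - n) 3 ltac:(lia)) as Hd.
  assert (Hc : ((m - n) mod 3 = 0 \/ (m - n) mod 3 = 1 \/ (m - n) mod 3 = 2)%Z) by lia.
  destruct Hc as [Hc | [Hc | Hc]]; rewrite Hc in Hd.
  - exists (RtoC 0). split; [now left |]. apply H. exists (lattice_point m n). split; [| ring].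
    apply hex_vec_lattice_point. exists ((m - n) / 3)%Z. lia.
  - exists (RtoC 1). split; [now right; left |]. apply H.
    exists (lattice_point (m - 1) n). split.
    + apply hex_vec_lattice_point. exists ((m - n) / 3)%Z. lia.
    + unfold lattice_point. rewrite minus_IZR, RtoC_minus. ring.
  - exists omega. split; [now right; right |]. apply H.
    exists (lattice_point m (n - 1)). split.
    + apply hex_vec_lattice_point. exists ((m - n) / 3 + 1)%Z. lia.
    + unfold lattice_point. rewrite minus_IZR, RtoC_minus. ring.
Qed.

(** * Local structure of the projection *)

(** The bound [rho <= 1] makes [rho] also a lower bound for the length of nonzero translations. *)
Definition separated (rho : R) (z : C) : Prop :=
  0 < rho <= 1 /\ forall k l : Z, rho <= Cmod (z - lattice_point k l)%C.

Lemma nonint_dist (x : R) : (forall k : Z, x <> IZR k) ->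
  exists d, 0 < d <= 1 /\ forall k : Z, d <= Rabs (x - IZR k).
Proof.
  intros Hx. destruct (archimed x) as [H1 H2].
  pose proof (Hx (up x - 1)%Z) as H3. rewrite minus_IZR in H3.
  exists (Rmin (x - (IZR (up x) - 1)) (IZR (up x) - x)). split.
  - split.
    + apply Rmin_glb_lt; lra.
    + apply Rle_trans with (1 := Rmin_r _ _). lra.
  - intros k. destruct (Z_le_gt_dec (up x) k) as [Hk | Hk].
    + apply IZR_le in Hk. apply Rle_trans with (1 := Rmin_r _ _).
      rewrite Rabs_minus_sym, Rabs_pos_eq; lra.
    + assert (Hk' : (k <= up x - 1)%Z) by lia. apply IZR_le in Hk'.
      rewrite minus_IZR in Hk'. apply Rle_trans with (1 := Rmin_l _ _).
      rewrite Rabs_pos_eq; lra.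
Qed.

Lemma separated_exists (z : C) :
  (forall k l : Z, z <> lattice_point k l) -> exists rho, separated rho z.
Proof.
  destruct (coord_surj z) as [x [y ->]]. intros H.
  assert (Hc : (forall k : Z, x <> IZR k) \/ (forall k : Z, y <> IZR k)).
  { destruct (classic (exists k : Z, x = IZR k)) as [[k ->] | Hx].
    - right. intros l ->. now apply (H k l).
    - left. intros k E. apply Hx. now exists k. }
  destruct Hc as [Hc | Hc]; destruct (nonint_dist _ Hc) as [d [Hd Hd']];
    exists (d / 2); (split; [lra |]); intros k l;
    rewrite lattice_point_coord, coord_minus.
  - pose proof (Cmod_coord_ge_l (x - IZR k) (y - IZR l)). specialize (Hd' k). lra.
  - pose proof (Cmod_coord_ge_r (x - IZR k) (y - IZR l)). specialize (Hd' l). lra.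
Qed.

(** For a nontrivial [u] one has [|u - 1| = sqrt 3]. Writing [h = (1 - u) p] exhibits [p] as the
    fixed point of [u z + h], so every rotation in the group is centred at a lattice point. *)
Lemma one_minus_rot_unit (u : C) : rot_unit u -> u <> 1%C ->
  1 <= Cmod (u - 1)%C /\
  forall h, hex_vec h -> exists k l, h = ((1 - u) * lattice_point k l)%C.
Proof.
  assert (Hone : forall v, Cmod (v - 1)%C = sqrt 3 -> 1 <= Cmod (v - 1)%C).
  { intros v ->. rewrite <- sqrt_1 at 1. apply sqrt_le_1_alt. lra. }
  intros Hu Hu1. destruct Hu as [-> | [-> | ->]]; [easy | |]; split.
  - apply Hone.
    replace (zeta - 1)%C with (coord (-2) 1).
    + rewrite Cmod_coord. f_equal. ring.
    + rewrite zeta_eq. change (-2) with (- (2)). replace 2 with (1 + 1) by ring.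
      unfold coord. rewrite RtoC_opp, RtoC_plus. ring.
  - intros h [a [b ->]]. exists a, (a + b)%Z.
    replace ((1 - zeta) * lattice_point a (a + b))%C
      with (lattice_point a (a + b) - zeta * lattice_point a (a + b))%C by ring.
    rewrite !lattice_point_coord, zeta_coord, coord_minus.
    f_equal; rewrite ?plus_IZR, ?mult_IZR; ring.
  - apply Hone.
    replace (zeta * zeta - 1)%C with (coord (-1) (-1)).
    + rewrite Cmod_coord. f_equal. ring.
    + rewrite zeta_eq. change (-1) with (- (1)).
      unfold coord. rewrite RtoC_opp.
      replace ((omega - 1) * (omega - 1))%C
        with (omega * omega - omega - omega + 1)%C by ring.
      rewrite omega_sqr. ring.
  - intros h [a [b ->]]. exists (b + 2 * a)%Z, (- a)%Z.
    replace ((1 - zeta * zeta) * lattice_point (b + 2 * a) (- a))%C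
      with (lattice_point (b + 2 * a) (- a)
            - zeta * (zeta * lattice_point (b + 2 * a) (- a)))%C by ring.
    rewrite !lattice_point_coord, !zeta_coord, coord_minus.
    f_equal; rewrite ?opp_IZR, ?plus_IZR, ?mult_IZR; ring.
Qed.

(* A rotation fixes a lattice point [p] and moves [z] by at least [|z - p|];
   a nonzero translation moves every point by at least 1. *)
Lemma Gamma333_displacement (g : C -> C) (rho : R) (z : C) :
  Gamma333 g -> separated rho z ->
  (forall w, g w = w) \/ rho <= Cmod (g z - z)%C.
Proof.
  intros Hg [Hrho Hsep].
  destruct (Gamma333_normal_form g Hg) as [u [h [Hu [Hh E]]]].
  destruct (classic (u = 1%C)) as [-> | Hu1].
  - destruct (classic (h = 0%C)) as [-> | Hh0].
    + left. intros w. rewrite E. ring.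
    + right. rewrite E. replace (1 * z + h - z)%C with h by ring.
      destruct Hh as [a [b ->]]. rewrite lattice_point_coord in Hh0 |- *.
      rewrite Cmod_coord. apply Rle_trans with 1; [easy |].
      rewrite <- sqrt_1 at 1. apply sqrt_le_1_alt.
      rewrite <- !mult_IZR, <- !plus_IZR. apply IZR_le.
      assert (Hab : (b + 3 * a <> 0 \/ b <> 0)%Z).
      { destruct (Z.eq_dec b 0) as [-> | ?]; [| now right].
        destruct (Z.eq_dec a 0) as [-> | ?]; [| left; lia].
        exfalso. apply Hh0. unfold coord. simpl (IZR _). ring. }
      revert Hab. generalize (b + 3 * a)%Z as c. intros c Hc.
      (* Four times [c^2 + c b + b^2] is [(2 c + b)^2 + 3 b^2], and symmetrically in [b] and [c]; so
         the form is a positive integer once one argument is nonzero. *)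
      pose proof (Z.square_nonneg (2 * c + b)) as H1.
      pose proof (Z.square_nonneg (2 * b + c)) as H2.
      destruct Hc as [Hc | Hc]; nia.
  - right. destruct (one_minus_rot_unit u Hu Hu1) as [Hm Hfix].
    destruct (Hfix h Hh) as [k [l ->]]. rewrite E.
    replace (u * z + (1 - u) * lattice_point k l - z)%C
      with ((u - 1) * (z - lattice_point k l))%C by ring.
    rewrite Cmod_mult. specialize (Hsep k l). nra.
Qed.

Lemma Cmod_minus_sym (z w : C) : Cmod (z - w)%C = Cmod (w - z)%C.
Proof. rewrite <- Cmod_opp. f_equal. ring. Qed.

(** If [g] is not the identity it moves [p] by at least [rho]. Then [g w] stays within [rho / 4] of
    [g p], hence at distance more than [rho / 2] from [z], whereas [z] and [w] are less than
    [rho / 2] apart. This is the origin of the radius [rho / 4]. *)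
Lemma Gamma333_local (g : C -> C) (rho : R) (p z w : C) :
  Gamma333 g -> separated rho p ->
  Cmod (z - p)%C < rho / 4 -> Cmod (w - p)%C < rho / 4 ->
  Cmod (z - w)%C <= Cmod (z - g w)%C.
Proof.
  intros Hg Hp Hz Hw.
  destruct (Gamma333_displacement g rho p Hg Hp) as [Hid | Hd].
  - rewrite Hid. lra.
  - pose proof (Gamma333_isometry g w p Hg) as Hi.
    pose proof (Cmod_triangle (z - p) (p - w)) as H1.
    replace (z - p + (p - w))%C with (z - w)%C in H1 by ring.
    rewrite (Cmod_minus_sym p w) in H1.
    pose proof (Cmod_triangle (g p - g w) (g w - z + (z - p))) as H2.
    pose proof (Cmod_triangle (g w - z) (z - p)) as H3.
    replace (g p - g w + (g w - z + (z - p)))%C with (g p - p)%C in H2 by ring.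
    rewrite (Cmod_minus_sym (g p) (g w)) in H2. rewrite (Cmod_minus_sym (g w) z) in H3.
    lra.
Qed.

Lemma proj_local_inj (rho : R) (p z w : C) :
  separated rho p -> Cmod (z - p)%C < rho / 4 -> Cmod (w - p)%C < rho / 4 ->
  proj z = proj w -> z = w.
Proof.
  intros Hp Hz Hw E. symmetry in E. apply proj_eq_iff in E. destruct E as [g [Hg Eg]].
  pose proof (Gamma333_local g rho p z w Hg Hp Hz Hw) as H.
  rewrite Eg in H. replace (z - z)%C with (RtoC 0) in H by ring. rewrite Cmod_0 in H.
  pose proof (Cmod_ge_0 (z - w)) as H'.
  assert (H0 : (z - w)%C = 0%C) by (apply Cmod_eq_0; lra).
  replace z with (z - w + w)%C by ring. rewrite H0. ring.
Qed.

(** [real] sends infinite values to 0, so these must be excluded: 0 bounds the set below, and a pair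
    of representatives rules out the infimum of the empty set. *)
Lemma dist2_glb (x y : DoubleDelta) :
  (forall z w, proj z = x -> proj w = y -> dist2 x y <= Cmod (z - w)%C) /\
  (forall d, (exists z w, proj z = x /\ proj w = y) ->
     (forall z w, proj z = x -> proj w = y -> d <= Cmod (z - w)%C) -> d <= dist2 x y).
Proof.
  unfold dist2.
  set (E := fun r => exists z w : C, proj z = x /\ proj w = y /\ r = Cmod (z - w)%C).
  pose proof (Glb_Rbar_correct E) as [Hlb Hglb].
  assert (H0 : Rbar_le 0 (Glb_Rbar E)).
  { apply Hglb. intros r [z [w [_ [_ ->]]]]. simpl. apply Cmod_ge_0. }
  split.
  - intros z w Hz Hw.
    assert (H := Hlb (Cmod (z - w)%C)
      (ex_intro _ z (ex_intro _ w (conj Hz (conj Hw eq_refl))))).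
    destruct (Glb_Rbar E); simpl in *; easy.
  - intros d [z [w [Hz Hw]]] Hd.
    assert (H := Hlb (Cmod (z - w)%C)
      (ex_intro _ z (ex_intro _ w (conj Hz (conj Hw eq_refl))))).
    assert (H' : Rbar_le d (Glb_Rbar E)).
    { apply Hglb. intros r [z' [w' [Hz' [Hw' ->]]]]. simpl. auto. }
    destruct (Glb_Rbar E); simpl in *; easy.
Qed.

Lemma dist2_le (z w : C) : dist2 (proj z) (proj w) <= Cmod (z - w)%C.
Proof. now apply dist2_glb. Qed.

Lemma dist2_local (rho : R) (p z w : C) :
  separated rho p -> Cmod (z - p)%C < rho / 4 -> Cmod (w - p)%C < rho / 4 ->
  dist2 (proj z) (proj w) = Cmod (z - w)%C.
Proof.
  intros Hp Hz Hw. apply Rle_antisym; [apply dist2_le |].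
  apply dist2_glb; [now exists z, w |].
  intros z' w' Ez Ew. symmetry in Ez, Ew.
  apply proj_eq_iff in Ez, Ew. destruct Ez as [g [Hg <-]]. destruct Ew as [k [Hk <-]].
  destruct (Gamma333_inverse g Hg) as [g' [Hg' [E1 E2]]].
  (* Moving both points by the inverse of [g] reduces two arbitrary representatives to the case
     where the first one is [z] itself. *)
  rewrite <- (E2 (k w)), (Gamma333_isometry g _ _ Hg).
  apply (Gamma333_local (fun x => g' (k x)) rho p); auto.
  now apply Gamma_comp.
Qed.

Lemma not_lattice_point (gamma : R -> DoubleDelta) (t : R) (z : C) :
  avoids_vertices gamma -> gamma t = proj z -> forall k l : Z, z <> lattice_point k l.
Proof.
  intros Hv E k l ->. destruct (proj_lattice_point k l) as [p [Hp Ep]].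
  apply (Hv t p Hp). now rewrite E, Ep.
Qed.

Lemma avoids_vertices_proj (f : R -> C) :
  (forall t (k l : Z), f t <> lattice_point k l) -> avoids_vertices (fun t => proj (f t)).
Proof.
  intros Hf t p Hp E. symmetry in E. apply proj_eq_iff in E. destruct E as [g [Hg E]].
  assert (Hl : exists k l, p = lattice_point k l).
  { unfold lattice_point. destruct Hp as [-> | [-> | ->]].
    - exists 0%Z, 0%Z. simpl (IZR _). ring.
    - exists 1%Z, 0%Z. simpl (IZR _). ring.
    - exists 0%Z, 1%Z. simpl (IZR _). ring. }
  destruct Hl as [k [l ->]].
  destruct (Gamma333_normal_form g Hg) as [u [h [Hu [[a [b ->]] F]]]].
  rewrite F in E. symmetry in E. revert E.
  assert (Hz : forall k l, (zeta * lattice_point k l)%C = lattice_point (- k - l) k).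
  { intros k' l'. rewrite !lattice_point_coord, zeta_coord, minus_IZR, opp_IZR. easy. }
  assert (Hp' : forall k l k' l',
    (lattice_point k l + lattice_point k' l')%C = lattice_point (k + k') (l + l')).
  { intros. rewrite !lattice_point_coord, coord_plus, !plus_IZR. easy. }
  destruct Hu as [-> | [-> | ->]].
  - rewrite Cmult_1_l, Hp'. apply Hf.
  - rewrite Hz, Hp'. apply Hf.
  - rewrite <- Cmult_assoc, !Hz, Hp'. apply Hf.
Qed.

(** * Geodesics are projections of straight lines *)

Lemma scaled_small (v : C) (e : R) : 0 < e ->
  exists d, 0 < d /\ forall tau, Rabs tau < d -> Cmod (RtoC tau * v)%C < e.
Proof.
  intros He. pose proof (Cmod_ge_0 v) as Hv.
  exists (e / (Cmod v + 1)). split; [apply Rdiv_lt_0_compat; lra |].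
  intros tau Htau. rewrite Cmod_mult, Cmod_R.
  apply Rle_lt_trans with (Rabs tau * (Cmod v + 1)).
  - pose proof (Rabs_pos tau). nra.
  - apply Rlt_le_trans with (e / (Cmod v + 1) * (Cmod v + 1)).
    + apply Rmult_lt_compat_r; lra.
    + right. field. lra.
Qed.

(* The projection is injective near [y + tau0 w], so one element of the group
   matches the two lines near [tau0]; being affine, it matches them throughout. *)
Lemma affine_lifts_agree (x v y w : C) (a b : R) : a < b ->
  (forall tau, a < tau < b -> proj (x + RtoC tau * v)%C = proj (y + RtoC tau * w)%C) ->
  (forall tau, a < tau < b -> forall k l, (y + RtoC tau * w)%C <> lattice_point k l) ->
  exists g, Gamma333 g /\ forall tau, g (x + RtoC tau * v)%C = (y + RtoC tau * w)%C.
Proof.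
  intros Hab Hproj Hlat. set (t0 := (a + b) / 2).
  assert (Ht0 : a < t0 < b) by (unfold t0; lra).
  destruct (separated_exists _ (Hlat t0 Ht0)) as [rho Hrho].
  assert (Hr : 0 < rho / 4) by (destruct Hrho; lra).
  destruct (proj1 (proj_eq_iff _ _) (Hproj t0 Ht0)) as [g [Hg E]].
  destruct (scaled_small v _ Hr) as [d1 [Hd1 Hv]].
  destruct (scaled_small w _ Hr) as [d2 [Hd2 Hw]].
  set (d := Rmin (Rmin d1 d2) ((b - a) / 2) / 2).
  assert (Hd : 0 < d /\ d < d1 /\ d < d2 /\ d < (b - a) / 2).
  { assert (H : 0 < Rmin (Rmin d1 d2) ((b - a) / 2)) by (repeat apply Rmin_glb_lt; lra).
    pose proof (Rmin_l (Rmin d1 d2) ((b - a) / 2)).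
    pose proof (Rmin_r (Rmin d1 d2) ((b - a) / 2)).
    pose proof (Rmin_l d1 d2). pose proof (Rmin_r d1 d2). unfold d. lra. }
  destruct (Gamma333_normal_form g Hg) as [u [h [Hu [_ F]]]].
  (* Agreement at the second parameter [t0 + d] gives equality of points, not only of orbits, and so
     determines the linear part: [u v = w]. *)
  assert (Hstep : g (x + RtoC (t0 + d) * v)%C = (y + RtoC (t0 + d) * w)%C).
  { apply (proj_local_inj rho (y + RtoC t0 * w)%C); [easy | | |].
    - rewrite <- E, (Gamma333_isometry g _ _ Hg), RtoC_plus.
      replace (x + (t0 + d) * v - (x + t0 * v))%C with (RtoC d * v)%C by ring.
      apply Hv. rewrite Rabs_pos_eq; lra.
    - rewrite RtoC_plus.
      replace (y + (t0 + d) * w - (y + t0 * w))%C with (RtoC d * w)%C by ring.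
      apply Hw. rewrite Rabs_pos_eq; lra.
    - rewrite (proj_Gamma333 g _ Hg). apply Hproj. unfold t0. lra. }
  assert (Huv : (u * v)%C = w).
  { assert (Hdc : RtoC d <> 0%C) by (intros H; apply RtoC_inj in H; lra).
    rewrite F, RtoC_plus in Hstep. rewrite F in E.
    replace (u * v)%C with
      ((u * (x + (t0 + d) * v) + h - (u * (x + t0 * v) + h)) / d)%C by (field; easy).
    rewrite Hstep, E. field. easy. }
  exists g. split; [easy |]. intros tau.
  rewrite F in E |- *.
  replace (u * (x + tau * v) + h)%C
    with (u * (x + t0 * v) + h + (tau - t0) * (u * v))%C by ring.
  rewrite E, Huv. ring.
Qed.

(** Equality case of the triangle inequality: the three squared lengths give the inner product
    [c^2 p q], and then [|q x - p y|^2 = 0]. *)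
Lemma triangle_equality (x y : C) (c p q : R) :
  0 <= p -> 0 <= q -> Cmod x = c * p -> Cmod y = c * q -> Cmod (x + y)%C = c * (p + q) ->
  (RtoC q * x)%C = (RtoC p * y)%C.
Proof.
  assert (Hsq : forall z r, Cmod z = r -> fst z * fst z + snd z * snd z = r * r).
  { intros z r <-. unfold Cmod. rewrite sqrt_sqrt; [simpl; ring |].
    pose proof (pow2_ge_0 (fst z)). pose proof (pow2_ge_0 (snd z)). lra. }
  intros Hp Hq Hx Hy Hxy. apply Hsq in Hx, Hy, Hxy.
  destruct x as [x1 x2], y as [y1 y2]. simpl in *.
  assert (Hin : x1 * y1 + x2 * y2 = c * c * p * q) by nra.
  assert (H0 : (q * x1 - p * y1) * (q * x1 - p * y1)
             + (q * x2 - p * y2) * (q * x2 - p * y2) = 0).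
  { replace ((q * x1 - p * y1) * (q * x1 - p * y1)
             + (q * x2 - p * y2) * (q * x2 - p * y2))
      with (q * q * (x1 * x1 + x2 * x2) + p * p * (y1 * y1 + y2 * y2)
            - 2 * p * q * (x1 * y1 + x2 * y2)) by ring.
    rewrite Hx, Hy, Hin. ring. }
  apply Rplus_sqr_eq_0 in H0. destruct H0 as [H1 H2].
  apply injective_projections; simpl; lra.
Qed.

(** Distances between [a], [s] and [b] add up, so [f s] lies on the segment from [f a] to [f b], at
    the proportional position. *)
Lemma isometric_segment (f : R -> C) (c a b : R) : a < b ->
  (forall s t, a <= s -> s <= t -> t <= b -> Cmod (f t - f s)%C = c * (t - s)) ->
  forall s, a <= s <= b ->
    f s = (f a + RtoC (s - a) * ((f b - f a) / RtoC (b - a)))%C.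
Proof.
  intros Hab Hf s Hs.
  assert (Hba : RtoC (b - a) <> 0%C) by (intros H; apply RtoC_inj in H; lra).
  assert (E : (RtoC (b - s) * (f s - f a))%C = (RtoC (s - a) * (f b - f s))%C).
  { apply (triangle_equality _ _ c); try lra.
    - apply Hf; lra.
    - apply Hf; lra.
    - replace (f s - f a + (f b - f s))%C with (f b - f a)%C by ring.
      replace (s - a + (b - s)) with (b - a) by ring. apply Hf; lra. }
  assert (E' : (RtoC (b - a) * (f s - f a))%C = (RtoC (s - a) * (f b - f a))%C).
  { replace (b - a) with (b - s + (s - a)) by ring.
    rewrite RtoC_plus.
    replace ((RtoC (b - s) + RtoC (s - a)) * (f s - f a))%C
      with (RtoC (b - s) * (f s - f a) + RtoC (s - a) * (f s - f a))%C by ring.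
    rewrite E. ring. }
  replace (RtoC (s - a) * ((f b - f a) / RtoC (b - a)))%C
    with (RtoC (s - a) * (f b - f a) / RtoC (b - a))%C by (field; easy).
  rewrite <- E'. field. easy.
Qed.

Lemma smooth_lift_near (f : R -> C) (t e : R) : 0 < e ->
  (forall n, ex_derive_n (fun u => fst (f u)) n t /\
             ex_derive_n (fun u => snd (f u)) n t) ->
  exists d, 0 < d /\ forall s, Rabs (s - t) < d -> Cmod (f s - f t)%C < e.
Proof.
  intros He Hf. destruct (Hf 1%nat) as [H1 H2].
  apply ex_derive_continuous in H1, H2.
  assert (He2 : 0 < e / 2) by lra.
  destruct (H1 _ (locally_ball _ (mkposreal _ He2))) as [d1 Hd1].
  destruct (H2 _ (locally_ball _ (mkposreal _ He2))) as [d2 Hd2].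
  exists (Rmin d1 d2). split; [apply Rmin_glb_lt; apply cond_pos |].
  intros s Hs.
  specialize (Hd1 s (Rlt_le_trans _ _ _ Hs (Rmin_l _ _))).
  specialize (Hd2 s (Rlt_le_trans _ _ _ Hs (Rmin_r _ _))).
  change (Rabs (fst (f s) - fst (f t)) < e / 2) in Hd1.
  change (Rabs (snd (f s) - snd (f t)) < e / 2) in Hd2.
  apply Rle_lt_trans with (1 := Cmod_2Rmax _).
  apply Rle_lt_trans with (2 * Rmax (Rabs (fst (f s - f t)%C)) (Rabs (snd (f s - f t)%C))).
  - apply Rmult_le_compat_r.
    + apply Rle_trans with (2 := Rmax_l _ _). apply Rabs_pos.
    + rewrite <- (sqrt_square 2) at 2 by lra. apply sqrt_le_1_alt. lra.
  - assert (H : Rmax (Rabs (fst (f s - f t)%C)) (Rabs (snd (f s - f t)%C)) < e / 2)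
      by (apply Rmax_lub_lt; assumption). lra.
Qed.

(** The base point [z] is the position at parameter 0, not at [t], so that lines found near
    different times share one parameter and can be compared. *)
Definition locally_straight (c : R) (gamma : R -> DoubleDelta) : Prop :=
  forall t, exists eps z v, 0 < eps /\ Cmod v = c /\
    forall s, Rabs (s - t) < eps -> gamma s = proj (z + RtoC s * v)%C.

(** Minimality turns the arc length [c (b - a)] into a quotient distance, which near a point off the
    lattice is the Euclidean distance of the smooth lift. The lift therefore scales distances by
    [c], which forces it to be affine. *)
Lemma geodesic_locally_straight (gamma : R -> DoubleDelta) (c : R) : 0 < c ->
  smooth_curve gamma -> avoids_vertices gamma -> locally_geodesic gamma ->
  (forall a b, a <= b -> arc_length gamma a b = Finite (c * (b - a))) ->
  locally_straight c gamma.
Proof.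
  intros Hc Hs Hv Hg Hl t.
  destruct (Hs t) as [e1 [f [He1 Hf]]]. destruct (Hg t) as [e2 [He2 Hmin]].
  assert (Htt : Rabs (t - t) < e1) by now rewrite Rminus_diag, Rabs_R0.
  destruct (Hf t Htt) as [Et Hft].
  destruct (separated_exists _ (not_lattice_point gamma t _ Hv Et)) as [rho Hrho].
  assert (Hr : 0 < rho / 4) by (destruct Hrho; lra).
  destruct (smooth_lift_near f t _ Hr Hft) as [e3 [He3 Hnear]].
  set (e := Rmin (Rmin e1 e2) e3 / 2).
  assert (He : 0 < e /\ e < e1 /\ e < e2 /\ e < e3).
  { assert (H : 0 < Rmin (Rmin e1 e2) e3) by (repeat apply Rmin_glb_lt; lra).
    pose proof (Rmin_l (Rmin e1 e2) e3). pose proof (Rmin_r (Rmin e1 e2) e3).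
    pose proof (Rmin_l e1 e2). pose proof (Rmin_r e1 e2). unfold e. lra. }
  assert (Hiso : forall a b, t - e <= a -> a <= b -> b <= t + e ->
                   Cmod (f b - f a)%C = c * (b - a)).
  { intros a b Ha Hab Hb.
    assert (Ha' : Rabs (a - t) <= e) by (apply Rabs_le; lra).
    assert (Hb' : Rabs (b - t) <= e) by (apply Rabs_le; lra).
    pose proof (Hl a b Hab) as H1. rewrite Hmin in H1 by lra.
    injection H1 as H1. rewrite <- H1, Cmod_minus_sym.
    destruct (Hf a) as [-> _]; [lra |]. destruct (Hf b) as [-> _]; [lra |].
    symmetry. apply (dist2_local rho (f t)); [easy | |]; apply Hnear; lra. }
  set (v := ((f (t + e)%R - f (t - e)%R) / RtoC (t + e - (t - e)))%C).
  exists e, (f (t - e)%R - RtoC (t - e) * v)%C, v. split; [lra |]. split.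
  - assert (Hne : RtoC (t + e - (t - e)) <> 0%C)
      by (intros H; apply RtoC_inj in H; lra).
    unfold v. rewrite Cmod_div by easy. rewrite Hiso by lra.
    rewrite Cmod_R, Rabs_pos_eq by lra. field. lra.
  - intros s Hst. destruct (Hf s) as [-> _]; [lra |]. f_equal.
    apply Rabs_def2 in Hst.
    rewrite (isometric_segment f c (t - e) (t + e)) by (easy || lra).
    fold v. rewrite (RtoC_minus s). ring.
Qed.

(** Supremum argument: the local line at the supremum overlaps the line already followed, a group
    element matches the two, and the agreement extends past the supremum. *)
Lemma straight_continuation (gamma : R -> DoubleDelta) (c : R) (p : C) :
  avoids_vertices gamma -> locally_straight c gamma -> gamma 0 = proj p ->
  exists v, Cmod v = c /\ forall s, 0 <= s -> gamma s = proj (p + RtoC s * v)%C.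
Proof.
  intros Hv Hloc H0.
  destruct (Hloc 0) as [e0 [z0 [v0 [He0 [Hc0 E0]]]]].
  assert (Hz : orbit z0 p).
  { apply proj_eq_iff. rewrite <- H0, E0; [f_equal; ring |].
    now rewrite Rminus_diag, Rabs_R0. }
  destruct Hz as [g [Hg Hgp]].
  destruct (Gamma333_normal_form g Hg) as [u [h [Hu [_ F]]]].
  set (v := (u * v0)%C).
  exists v. split.
  { unfold v. rewrite Cmod_mult, (Cmod_rot_unit u Hu), Hc0. ring. }
  assert (Hstart : forall s, 0 <= s < e0 -> gamma s = proj (p + RtoC s * v)%C).
  { intros s Hs. rewrite E0 by (rewrite Rminus_0_r, Rabs_pos_eq; lra).
    rewrite <- (proj_Gamma333 g _ Hg), <- Hgp, !F. f_equal. unfold v. ring. }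
  intros M HM. apply NNPP. intros Hbad.
  set (E := fun x => 0 <= x <= M /\
    forall s, 0 <= s <= x -> gamma s = proj (p + RtoC s * v)%C).
  destruct (completeness E) as [x [Hub Hlub]].
  - exists M. intros y [Hy _]. lra.
  - exists 0. split; [lra |]. intros s Hs. apply Hstart. lra.
  - assert (HxM : x <= M) by (apply Hlub; intros y [Hy _]; lra).
    assert (HMe : e0 <= M).
    { destruct (Rle_lt_dec e0 M); [easy |]. exfalso. apply Hbad, Hstart. lra. }
    assert (Hx0 : e0 / 2 <= x).
    { apply Hub. split; [lra |]. intros s Hs. apply Hstart. lra. }
    destruct (Hloc x) as [e [z [v' [He [_ Ex]]]]].
    (* The overlap is the interval from [y] to some [b] in [E] above [y], which exists because [x]
       is the least upper bound. *)
    set (y := Rmax 0 (x - e)).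
    assert (Hy : 0 <= y < x) by (unfold y; split; [apply Rmax_l | apply Rmax_lub_lt; lra]).
    assert (Hye : x - e <= y) by apply Rmax_r.
    assert (Hex : exists b, E b /\ y < b).
    { apply NNPP. intros Hno. apply (Rlt_not_le x y); [easy |].
      apply Hlub. intros b Hb. apply Rnot_lt_le. intros Hyb. apply Hno. now exists b. }
    destruct Hex as [b [[HbM Hb] Hyb]].
    assert (Hbx : b <= x) by now apply Hub.
    destruct (affine_lifts_agree z v' p v y b Hyb) as [k [Hk Ek]].
    { intros tau Htau. rewrite <- Hb, <- Ex; [easy | apply Rabs_def1 |]; lra. }
    { intros tau Htau. apply (not_lattice_point gamma tau _ Hv). apply Hb. lra. }
    assert (Hext : forall s, 0 <= s < x + e -> gamma s = proj (p + RtoC s * v)%C).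
    { intros s Hs. destruct (Rle_lt_dec s b) as [Hsb | Hsb]; [apply Hb; lra |].
      rewrite <- Ek, (proj_Gamma333 k _ Hk). apply Ex. apply Rabs_def1; lra. }
    destruct (Rlt_le_dec M (x + e)) as [HMx | HMx].
    + apply Hbad, Hext. lra.
    + assert (Hc : E (x + e / 2)).
      { split; [lra |]. intros s Hs. apply Hext. lra. }
      apply Hub in Hc. lra.
Qed.

(** Were [u] nontrivial, the positive ratio [t / s] would be a root of [X^2 + X + 1]; cleared of
    denominators this is the positive factor [s^2 + s t + t^2]. *)
Lemma rot_unit_positive (u v : C) (s t : R) :
  rot_unit u -> v <> 0%C -> 0 < s -> 0 < t ->
  (u * (RtoC s * v))%C = (RtoC t * v)%C -> u = 1%C.
Proof.
  intros Hu Hv Hs Ht E. destruct (coord_surj v) as [x [y ->]].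
  assert (Hxy : x = 0 -> y = 0 -> False).
  { intros -> ->. apply Hv. unfold coord. ring. }
  rewrite !coord_scal in E.
  assert (Hq : 0 < s * s + s * t + t * t) by nra.
  destruct Hu as [-> | [-> | ->]]; [easy | |]; exfalso.
  - rewrite zeta_coord in E. apply coord_inj in E. destruct E as [E1 E2].
    assert (Hx : x * (s * s + s * t + t * t) = 0).
    { replace (x * (s * s + s * t + t * t))
        with (s * (s * x) + t * (s * x) + t * (t * x)) by ring.
      rewrite <- E1, E2. ring. }
    apply Rmult_integral in Hx. destruct Hx as [-> | Hx]; [| lra].
    apply Hxy; nra.
  - rewrite <- Cmult_assoc, !zeta_coord in E. apply coord_inj in E. destruct E as [E1 E2].
    assert (Hy : y * (s * s + s * t + t * t) = 0).
    { replace (y * (s * s + s * t + t * t))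
        with (s * (s * y) + t * (s * y) + t * (t * y)) by ring.
      rewrite <- E2. replace (s * y) with (t * x) by lra. ring. }
    apply Rmult_integral in Hy. destruct Hy as [-> | Hy]; [| lra].
    apply Hxy; nra.
Qed.

(** Two points on a ray sent to two points on a ray of the same direction force the linear part to
    be 1. The parameters [s] and [t] may differ, which serves laps of unequal speed. *)
Lemma parallel_transport (g : C -> C) (p q v : C) (s t : R) :
  Gamma333 g -> v <> 0%C -> 0 < s -> 0 < t ->
  g p = q -> g (p + RtoC s * v)%C = (q + RtoC t * v)%C -> hex_vec (q - p)%C.
Proof.
  intros Hg Hv Hs Ht Ep Es.
  destruct (Gamma333_normal_form g Hg) as [u [h [Hu [Hh F]]]].
  rewrite F in Ep, Es.
  assert (Hu1 : u = 1%C).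
  { apply (rot_unit_positive u v s t); auto.
    replace (u * (s * v))%C with (u * (p + s * v) + h - (u * p + h))%C by ring.
    rewrite Es, Ep. ring. }
  replace (q - p)%C with h; [easy |]. rewrite <- Ep, Hu1. ring.
Qed.

(** * Straight curves of rational direction *)

Lemma straight_curve_scaled (w v : C) (c t : R) : (RtoC c * w)%C = v ->
  straight_curve w (c * t) = proj (RtoC (1 / 2) + RtoC t * v)%C.
Proof. intros <-. unfold straight_curve. f_equal. rewrite RtoC_mult. ring. Qed.

(* The determinant of [1/2 + t (m + n omega) - (k + l omega)] against [m + n omega]
   is [n / 2] plus an integer, hence at least [1 / 2] in absolute value. *)
Lemma line_separated (m n : Z) : Z.Odd n ->
  exists rho, forall t, separated rho (RtoC (1 / 2) + RtoC t * lattice_point m n)%C.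
Proof.
  intros [q Hq].
  assert (Hn : 1 <= Rabs (IZR n)) by (rewrite <- abs_IZR; apply IZR_le; lia).
  pose proof (Rabs_pos (IZR m)) as Hm.
  (* From [1/2 <= |n| |X| + |m| |Y|], where [|X|] and [|Y|] are each at most twice the modulus. *)
  exists (/ (4 * (Rabs (IZR n) + Rabs (IZR m)))). intros t. split.
  - split; [apply Rinv_0_lt_compat; lra |].
    rewrite <- Rinv_1. apply Rinv_le_contravar; lra.
  - intros k l.
    replace (RtoC (1 / 2) + RtoC t * lattice_point m n - lattice_point k l)%C
      with (coord (1 / 2 + t * IZR m - IZR k) (t * IZR n - IZR l)).
    2:{ rewrite !lattice_point_coord, coord_scal.
        replace (RtoC (1 / 2)) with (coord (1 / 2) 0) by (unfold coord; ring).
        rewrite coord_plus, coord_minus. f_equal; ring. }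
    set (X := 1 / 2 + t * IZR m - IZR k). set (Y := t * IZR n - IZR l).
    pose proof (Cmod_coord_ge_l X Y) as HX. pose proof (Cmod_coord_ge_r X Y) as HY.
    assert (Hdet : 1 / 2 <= Rabs (IZR n * X - IZR m * Y)).
    { replace (IZR n * X - IZR m * Y) with (IZR (n - 2 * n * k + 2 * m * l) / 2).
      - unfold Rdiv. rewrite Rabs_mult, (Rabs_pos_eq (/ 2)) by lra.
        rewrite <- abs_IZR. apply Rmult_le_compat_r; [lra |]. apply IZR_le. lia.
      - rewrite plus_IZR, minus_IZR, !mult_IZR. unfold X, Y. field. }
    pose proof (Rabs_triang (IZR n * X) (- (IZR m * Y))) as Htri.
    rewrite Rabs_Ropp, !Rabs_mult in Htri.
    apply Rmult_le_reg_l with (4 * (Rabs (IZR n) + Rabs (IZR m))); [lra |].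
    rewrite Rinv_r by lra. unfold Rminus in Hdet.
    pose proof (Rabs_pos (IZR n)). nra.
Qed.

Lemma separated_not_lattice (rho : R) (z : C) (k l : Z) :
  separated rho z -> z <> lattice_point k l.
Proof.
  intros [Hr Hs] ->. specialize (Hs k l).
  replace (lattice_point k l - lattice_point k l)%C with (RtoC 0) in Hs by ring.
  rewrite Cmod_0 in Hs. lra.
Qed.

Lemma odd_lattice_point_neq_0 (m n : Z) : Z.Odd n -> lattice_point m n <> 0%C.
Proof.
  intros [q Hq] E.
  replace (RtoC 0) with (coord 0 0) in E by (unfold coord; ring).
  rewrite lattice_point_coord in E. apply coord_inj in E. destruct E as [_ E].
  apply (eq_IZR n 0) in E. lia.
Qed.

(** * Distance and length along a straight line *)

Lemma line_dist2_le (p v : C) (s t : R) :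
  dist2 (proj (p + RtoC s * v)%C) (proj (p + RtoC t * v)%C) <= Cmod v * Rabs (s - t).
Proof.
  apply Rle_trans with (1 := dist2_le _ _). right.
  replace (p + s * v - (p + t * v))%C with (v * RtoC (s - t))%C
    by (rewrite RtoC_minus; ring).
  now rewrite Cmod_mult, Cmod_R.
Qed.

Lemma line_dist2_local (p v : C) (rho : R) : v <> 0%C ->
  (forall t, separated rho (p + RtoC t * v)%C) ->
  exists d, 0 < d /\ forall s t, Rabs (s - t) < d ->
    dist2 (proj (p + RtoC s * v)%C) (proj (p + RtoC t * v)%C) = Cmod v * Rabs (s - t).
Proof.
  intros Hv Hsep.
  assert (Hr : 0 < rho / 4) by (destruct (Hsep 0) as [[H _] _]; lra).
  destruct (scaled_small v _ Hr) as [d [Hd Hsmall]].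
  exists d. split; [easy |]. intros s t Hst.
  assert (E : (p + s * v - (p + t * v))%C = (RtoC (s - t) * v)%C)
    by (rewrite RtoC_minus; ring).
  rewrite (dist2_local rho (p + RtoC t * v)%C).
  - rewrite E, Cmod_mult, Cmod_R. ring.
  - apply Hsep.
  - rewrite E. now apply Hsmall.
  - replace (p + t * v - (p + t * v))%C with (RtoC 0) by ring. now rewrite Cmod_0.
Qed.

(** The Lipschitz bound telescopes to give the upper estimate; a partition of mesh below [d] attains
    it. *)
Lemma arc_length_uniform (gamma : R -> DoubleDelta) (c d : R) : 0 < d ->
  (forall s t, dist2 (gamma s) (gamma t) <= c * Rabs (s - t)) ->
  (forall s t, Rabs (s - t) < d -> dist2 (gamma s) (gamma t) = c * Rabs (s - t)) ->
  forall a b, a <= b -> arc_length gamma a b = Finite (c * (b - a)).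
Proof.
  intros Hd Hle Heq a b Hab. apply is_lub_Rbar_unique. split.
  - intros l [n [sigma [Ha [Hb [Hmon ->]]]]]. simpl. rewrite <- Ha, <- Hb. clear Ha Hb.
    induction n as [| n IH].
    + rewrite sum_O. apply Rle_trans with (1 := Hle _ _).
      rewrite Rabs_minus_sym, Rabs_pos_eq; [lra |].
      specialize (Hmon O (Nat.le_refl _)). lra.
    + rewrite sum_Sn.
      specialize (IH (fun i Hi => Hmon i (Nat.le_trans _ _ _ Hi (Nat.le_succ_diag_r n)))).
      assert (H := Hle (sigma (S n)) (sigma (S (S n)))).
      rewrite Rabs_minus_sym, Rabs_pos_eq in H
        by (specialize (Hmon (S n) (Nat.le_refl _)); lra).
      change (sum_n (fun i => dist2 (gamma (sigma i)) (gamma (sigma (S i)))) n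
              + dist2 (gamma (sigma (S n))) (gamma (sigma (S (S n))))
              <= c * (sigma (S (S n)) - sigma 0%nat)).
      lra.
  - intros B HB. apply HB.
    (* With [n] the integer part of [(b - a) / d], the [n + 1] equal steps are shorter than [d]. *)
    destruct (nfloor_ex ((b - a) / d)) as [n [_ Hn]].
    { apply Rdiv_le_0_compat; lra. }
    pose proof (pos_INR n) as Hn0.
    set (h := (b - a) / (INR n + 1)).
    assert (Hh : h * (INR n + 1) = b - a) by (unfold h; field; lra).
    assert (Hh0 : 0 <= h) by (unfold h; apply Rdiv_le_0_compat; lra).
    assert (Hhd : h < d).
    { apply (Rmult_lt_compat_r d) in Hn; [| easy].
      replace ((b - a) / d * d) with (b - a) in Hn by (field; lra). nra. }
    exists n, (fun i => a + INR i * h). split; [simpl; ring |].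
    split; [rewrite S_INR; lra |]. split.
    + intros i _. rewrite S_INR. lra.
    + rewrite (sum_n_ext _ (fun _ => c * h)).
      * rewrite sum_n_const, S_INR, <- Hh. ring.
      * intros i. rewrite S_INR.
        assert (E : Rabs (a + INR i * h - (a + (INR i + 1) * h)) = h).
        { rewrite Rabs_minus_sym, Rabs_pos_eq; lra. }
        rewrite Heq; rewrite E; easy.
Qed.

Lemma ex_derive_n_affine (f : R -> R) (a b : R) (n : nat) (x : R) :
  (forall u, f u = a + u * b) -> ex_derive_n f n x.
Proof.
  intros Hf.
  assert (H : forall n, exists a' b', forall u, Derive_n f n u = a' + u * b').
  { induction n0 as [| k [a' [b' IH]]]; [now exists a, b |].
    exists b', 0. intros u. simpl. rewrite (Derive_ext _ _ _ IH).
    apply is_derive_unique. auto_derive; [easy | ring]. }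
  destruct n as [| n]; [easy |]. simpl. destruct (H n) as [a' [b' E]].
  apply (ex_derive_ext (fun u => a' + u * b')); [intros u; now rewrite E |].
  auto_derive. easy.
Qed.

Lemma line_smooth (p v : C) : smooth_curve (fun t => proj (p + RtoC t * v)%C).
Proof.
  intros t. exists 1, (fun s => p + RtoC s * v)%C. split; [lra |].
  intros s _. split; [easy |]. intros n. split.
  - apply (ex_derive_n_affine _ (fst p) (fst v)). intros u. simpl. ring.
  - apply (ex_derive_n_affine _ (snd p) (snd v)). intros u. simpl. ring.
Qed.

Lemma line_proportional (p v : C) (rho : R) : v <> 0%C ->
  (forall t, separated rho (p + RtoC t * v)%C) ->
  proportional_to_arc_length (fun t => proj (p + RtoC t * v)%C).
Proof.
  intros Hv Hsep. destruct (line_dist2_local p v rho Hv Hsep) as [d [Hd Heq]].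
  exists (Cmod v). split; [now apply Cmod_gt_0 |].
  apply (arc_length_uniform _ _ d); [easy | | easy]. intros. apply line_dist2_le.
Qed.

Lemma line_closed_geodesic (p v : C) (rho T : R) : v <> 0%C ->
  (forall t, separated rho (p + RtoC t * v)%C) ->
  0 < T -> hex_vec (RtoC T * v)%C ->
  closed_geodesic T (fun t => proj (p + RtoC t * v)%C).
Proof.
  intros Hv Hsep HT Hhex.
  destruct (line_dist2_local p v rho Hv Hsep) as [d [Hd Heq]].
  assert (Hv0 : 0 < Cmod v) by now apply Cmod_gt_0.
  split; [split; [easy | split] | split; [| split]].
  - intros t. rewrite RtoC_plus.
    replace (p + (t + T) * v)%C with (p + t * v + T * v)%C by ring.
    now apply proj_translate.
  - apply line_smooth.
  - apply avoids_vertices_proj. intros t k l. now apply (separated_not_lattice rho).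
  - exists (d / 2). intros E.
    assert (H1 := Heq (d / 2) 0). assert (H0 := Heq 0 0).
    rewrite Rminus_0_r, Rabs_pos_eq in H1 by lra.
    rewrite Rminus_0_r, Rabs_R0 in H0. rewrite E, H0 in H1 by lra.
    specialize (H1 ltac:(lra)). nra.
  - intros t. exists (d / 2). split; [lra |]. intros a b Ha Hab Hb.
    rewrite (arc_length_uniform _ (Cmod v) d) by (easy || intros; apply line_dist2_le).
    rewrite Heq; rewrite Rabs_minus_sym, Rabs_pos_eq by lra; [easy | lra].
Qed.

(** Both [t m] and [t n] are integers, so by a Bezout relation [t = u (t m) + v (t n)] is an integer
    too. *)
Lemma hex_vec_multiple (m n : Z) (t : R) : rel_prime m n ->
  hex_vec (RtoC t * lattice_point m n)%C <-> exists k, t = IZR k /\ (3 | k * (m - n))%Z.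
Proof.
  intros Hmn. split.
  - intros [a [b E]]. rewrite !lattice_point_coord, coord_scal in E.
    apply coord_inj in E. destruct E as [E1 E2].
    destruct (rel_prime_bezout m n Hmn) as [u v Huv].
    assert (Hk : t = IZR (u * (b + 3 * a) + v * b)).
    { rewrite plus_IZR, (mult_IZR u), (mult_IZR v), <- E1, <- E2.
      replace (IZR u * (t * IZR m) + IZR v * (t * IZR n))
        with (t * (IZR u * IZR m + IZR v * IZR n)) by ring.
      rewrite <- !mult_IZR, <- plus_IZR, Huv. ring. }
    exists (u * (b + 3 * a) + v * b)%Z. split; [easy |].
    rewrite Hk, <- mult_IZR in E1, E2. apply eq_IZR in E1, E2.
    exists a. rewrite Z.mul_sub_distr_l, E1, E2. ring.
  - intros [k [-> Hk]].
    replace (IZR k * lattice_point m n)%C with (lattice_point (k * m) (k * n)).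
    + apply hex_vec_lattice_point. now rewrite <- Z.mul_sub_distr_l.
    + rewrite !lattice_point_coord, coord_scal, !mult_IZR. easy.
Qed.

(** A rescaling only prescribes the curve on one period; periodicity carries the equality to all
    parameters. *)
Lemma periodic_agree (A : Type) (f g : R -> A) (T : R) : 0 < T ->
  (forall t, f (t + T) = f t) -> (forall t, g (t + T) = g t) ->
  (forall t, 0 <= t <= T -> f t = g t) -> forall t, f t = g t.
Proof.
  intros HT Hf Hg Hfg.
  assert (Hper : forall e : R -> A, (forall t, e (t + T) = e t) ->
            forall (k : Z) t, e (t + IZR k * T) = e t).
  { intros e He k. induction k as [| k IH | k IH] using Z.peano_ind; intros t.
    - f_equal. ring.
    - rewrite succ_IZR. replace (t + (IZR k + 1) * T) with (t + IZR k * T + T) by ring.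
      now rewrite He.
    - rewrite <- Z.sub_1_r, minus_IZR, <- He.
      replace (t + (IZR k - 1) * T + T) with (t + IZR k * T) by ring. easy. }
  intros t. destruct (archimed (t / T)) as [H1 H2].
  rewrite <- (Hper f Hf (1 - up (t / T))%Z), <- (Hper g Hg (1 - up (t / T))%Z).
  apply Hfg. rewrite minus_IZR.
  assert (E : t = t / T * T) by (field; lra). nra.
Qed.

(** * Primitivity *)

(* If [delta] is traversed at least twice, the curve retraces near the end [t1]
   of the first lap its initial segment, in the same direction; matching lifts at
   a single later point already forces the group element to be a translation. *)
Lemma iterate_translation (p v : C) (T S : R) (k : nat) (delta : R -> DoubleDelta) :
  v <> 0%C -> (forall t k l, (p + RtoC t * v)%C <> lattice_point k l) ->
  0 < T -> 0 < S -> (forall t, delta (t + S) = delta t) -> (2 <= k)%nat ->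
  iterate_of k S delta T (fun t => proj (p + RtoC t * v)%C) ->
  exists t1, 0 < t1 < T /\ hex_vec (RtoC t1 * v)%C.
Proof.
  intros Hv Hlat HT HS Hper Hk [phi [Hcont [Hmon [H0 [HkS Hphi]]]]].
  assert (Hc : Ranalysis1.continuity phi).
  { intros t. apply continuity_pt_filterlim, Hcont. }
  assert (Hinc : forall s t, s <= t -> phi s <= phi t).
  { intros s t [Hst | ->]; [left; auto | lra]. }
  assert (HST : S < phi T).
  { rewrite HkS. apply le_INR in Hk. simpl in Hk. nra. }
  (* [t1] ends the first lap of [delta]; it comes before [T] because there are at least two laps. *)
  destruct (IVT_gen phi 0 T S Hc) as [t1 [Ht1 E1]].
  { rewrite H0, Rmin_left, Rmax_right by lra. lra. }
  rewrite Rmin_left, Rmax_right in Ht1 by lra.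
  assert (Ht1' : 0 < t1 < T).
  { destruct Ht1 as [[Ha | <-] [Hb | ->]]; lra. }
  exists t1. split; [easy |].
  assert (Eg : orbit (p + RtoC 0 * v)%C (p + RtoC t1 * v)%C).
  { apply proj_eq_iff. rewrite !Hphi, H0, E1, <- (Hper 0) by lra. f_equal. ring. }
  destruct Eg as [g [Hg Eg]].
  destruct (separated_exists _ (Hlat t1)) as [rho Hrho].
  assert (Hr : 0 < rho / 4) by (destruct Hrho; lra).
  destruct (scaled_small v _ Hr) as [d [Hd Hsmall]].
  set (e := Rmin d T / 2).
  assert (He : 0 < e /\ e < d /\ e < T).
  { assert (H : 0 < Rmin d T) by (apply Rmin_glb_lt; lra).
    pose proof (Rmin_l d T). pose proof (Rmin_r d T). unfold e. lra. }
  assert (Hpe : 0 < phi e) by (rewrite <- H0; apply Hmon; lra).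
  destruct (Hcont t1 _ (locally_ball _ (mkposreal _ Hpe))) as [d' Hd'].
  set (r := Rmin (Rmin d d') (T - t1) / 2).
  assert (Hr' : 0 < r /\ r < d /\ r < d' /\ r < T - t1).
  { assert (H : 0 < Rmin (Rmin d d') (T - t1)).
    { repeat apply Rmin_glb_lt; try lra. apply cond_pos. }
    pose proof (Rmin_l (Rmin d d') (T - t1)). pose proof (Rmin_r (Rmin d d') (T - t1)).
    pose proof (Rmin_l d d'). pose proof (Rmin_r d d'). unfold r. lra. }
  assert (Hps : S < phi (t1 + r) < S + phi e).
  { split; [rewrite <- E1; apply Hmon; lra |].
    assert (Hb : ball t1 d' (t1 + r)).
    { change (Rabs (t1 + r - t1) < d').
      replace (t1 + r - t1) with r by ring. rewrite Rabs_pos_eq; lra. }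
    specialize (Hd' _ Hb). change (Rabs (phi (t1 + r) - phi t1) < phi e) in Hd'.
    apply Rabs_def2 in Hd'. lra. }
  (* [t] is the time in the first lap at which [delta] is where it is at time [t1 + r], one lap
     later. As [phi] need not be linear, [t] and [r] may differ; both are below [d], so local
     injectivity applies. *)
  destruct (IVT_gen phi 0 e (phi (t1 + r) - S) Hc) as [t [Ht Et]].
  { rewrite H0, Rmin_left, Rmax_right by lra. lra. }
  rewrite Rmin_left, Rmax_right in Ht by lra.
  assert (Ht0 : 0 < t).
  { destruct Ht as [[Ha | <-] _]; [easy |]. rewrite H0 in Et. lra. }
  assert (Es : g (p + RtoC t * v)%C = (p + RtoC t1 * v + RtoC r * v)%C).
  { apply (proj_local_inj rho (p + RtoC t1 * v)%C); [easy | | |].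
    - rewrite <- Eg, (Gamma333_isometry g _ _ Hg).
      replace (p + t * v - (p + 0 * v))%C with (RtoC t * v)%C by ring.
      apply Hsmall. rewrite Rabs_pos_eq; lra.
    - replace (p + t1 * v + r * v - (p + t1 * v))%C with (RtoC r * v)%C by ring.
      apply Hsmall. rewrite Rabs_pos_eq; lra.
    - rewrite (proj_Gamma333 g _ Hg).
      replace (p + t1 * v + r * v)%C with (p + RtoC (t1 + r) * v)%C
        by (rewrite RtoC_plus; ring).
      rewrite !Hphi, Et, <- (Hper (phi (t1 + r) - S)) by lra. f_equal. ring. }
  replace (t1 * v)%C with (p + t1 * v - p)%C by ring.
  apply (parallel_transport g p (p + RtoC t1 * v)%C v t r); try easy.
  rewrite <- Eg. f_equal. ring.
Qed.

(** If 3 divides [m - n], every integer factor gives a translation; otherwise, 3 being prime, it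
    must divide the factor. *)
Lemma primitive_period (m n : Z) (t T0 : R) : rel_prime m n ->
  (Hex (lattice_point m n) /\ T0 = 1 \/ ~ Hex (lattice_point m n) /\ T0 = 3) ->
  hex_vec (RtoC t * lattice_point m n)%C <-> exists k, t = IZR k * T0.
Proof.
  intros Hmn HT0. rewrite hex_vec_multiple by easy. rewrite Hex_lattice_point in HT0.
  destruct HT0 as [[Hhex ->] | [Hhex ->]].
  - split.
    + intros [k [-> _]]. exists k. ring.
    + intros [k ->]. exists k. split; [ring | now apply Z.divide_mul_r].
  - split.
    + intros [k [-> Hk]]. apply prime_mult in Hk; [| apply prime_3].
      destruct Hk as [[j ->] | Hk]; [| easy]. exists j. now rewrite mult_IZR.
    + intros [k ->]. exists (k * 3)%Z. rewrite mult_IZR. split; [easy |].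
      apply Z.divide_mul_l. now exists k.
Qed.

(** * The two implications *)

Lemma geodesic_is_rescaled_line (T : R) (gamma : R -> DoubleDelta) :
  smooth_closed_curve T gamma -> gamma 0 = proj (RtoC (1 / 2)) ->
  avoids_vertices gamma -> locally_geodesic gamma -> proportional_to_arc_length gamma ->
  exists (m n : Z) (c : R), rel_prime m n /\ Z.Odd n /\ 0 < c /\
    hex_vec (RtoC (c * T) * lattice_point m n)%C /\
    forall t, 0 <= t <= T -> gamma t = straight_curve (lattice_point m n) (c * t).
Proof.
  intros [HT [Hper Hsm]] H0 Hv Hgeo [c [Hc Hlen]].
  set (p := RtoC (1 / 2)) in *.
  destruct (straight_continuation gamma c p Hv
    (geodesic_locally_straight gamma c Hc Hsm Hv Hgeo Hlen) H0) as [v [Hcv Hline]].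
  assert (Hv0 : v <> 0%C) by (intros ->; rewrite Cmod_0 in Hcv; lra).
  (* By periodicity the lines from [p] and from [p + T v], both of direction [v], have the same
     projection; the group element matching them keeps the direction, so it is a translation. *)
  assert (Hhex : hex_vec (RtoC T * v)%C).
  { destruct (affine_lifts_agree p v (p + RtoC T * v)%C v 0 1 ltac:(lra))
      as [g [Hg Eg]].
    - intros tau Htau. rewrite <- (Hline tau), <- Hper, Hline by lra.
      f_equal. rewrite RtoC_plus. ring.
    - intros tau Htau.
      apply (not_lattice_point gamma (tau + T) _ Hv). rewrite Hline by lra.
      f_equal. rewrite RtoC_plus. ring.
    - replace (T * v)%C with (p + T * v - p)%C by ring.
      apply (parallel_transport g p (p + RtoC T * v)%C v 1 1); try easy; try lra.
      rewrite <- (Cplus_0_r p) at 1. replace (RtoC 0) with (RtoC 0 * v)%C by ring.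
      rewrite Eg. ring. }
  destruct Hhex as [a' [b Eab]]. set (a := (b + 3 * a')%Z) in *.
  assert (Hab : (a <> 0 \/ b <> 0)%Z).
  { apply NNPP. intros H. assert (Ha : a = 0%Z /\ b = 0%Z) by lia.
    destruct Ha as [-> ->]. apply Hv0.
    assert (HTC : RtoC T <> 0%C) by (intros HT'; apply RtoC_inj in HT'; lra).
    replace v with (T * v / T)%C by (field; easy). rewrite Eab.
    unfold lattice_point. simpl (IZR _). field. easy. }
  set (d := Z.gcd a b).
  assert (Hd : (0 < d)%Z).
  { pose proof (Z.gcd_nonneg a b). assert (Hd0 : d <> 0%Z); [| unfold d in *; lia].
    intros Hd0. apply Z.gcd_eq_0 in Hd0. lia. }
  destruct (Z.gcd_divide_l a b) as [m Hm]. destruct (Z.gcd_divide_r a b) as [n Hn].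
  fold d in Hm, Hn.
  assert (Hmn : rel_prime m n).
  { apply Zgcd_1_rel_prime. apply (Z.mul_reg_r _ _ d); [lia |].
    rewrite <- Z.gcd_mul_mono_r_nonneg, <- Hm, <- Hn by lia. unfold d. ring. }
  apply IZR_lt in Hd.
  assert (Hc' : 0 < IZR d / T) by (apply Rdiv_lt_0_compat; lra).
  assert (Ev : (RtoC (IZR d) * lattice_point m n)%C = (RtoC T * v)%C).
  { rewrite Eab, Hm, Hn, !lattice_point_coord, coord_scal, !mult_IZR.
    f_equal; ring. }
  assert (Ev' : (RtoC (IZR d / T) * lattice_point m n)%C = v).
  { assert (HTC : RtoC T <> 0%C) by (intros HT'; apply RtoC_inj in HT'; lra).
    rewrite RtoC_div by lra.
    replace (IZR d / T * lattice_point m n)%C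
      with (IZR d * lattice_point m n / T)%C by (field; easy).
    rewrite Ev. field. easy. }
  exists m, n, (IZR d / T). split; [easy |]. split; [| split; [easy | split]].
  - destruct (Z.Even_or_Odd n) as [[n' Hn'] | Ho]; [exfalso | easy].
    destruct (Z.Even_or_Odd m) as [[m' Hm'] | [m' Hm']].
    + assert (H2 : (2 | 1)%Z).
      { destruct Hmn as [_ _ Hmn]. apply Hmn; [exists m' | exists n']; lia. }
      apply Z.divide_1_r in H2. lia.
    (* With [n] even and [m] odd, half of [m + n omega] leads from [1/2] to a lattice point; with
       speed factor [d / T] this happens at time [T / (2 d)]. *)
    + assert (Hs : 0 <= / (2 * (IZR d / T))) by (left; apply Rinv_0_lt_compat; lra).
      apply (not_lattice_point gamma _ _ Hv (Hline _ Hs) (m' + 1)%Z n').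
      rewrite <- Ev', Hm', Hn', !lattice_point_coord, !coord_scal.
      replace p with (coord (1 / 2) 0) by (unfold p, coord; ring).
      rewrite coord_plus. rewrite !plus_IZR, !mult_IZR. f_equal; field; lra.
  - replace (IZR d / T * T) with (IZR d) by (field; lra). rewrite Ev. now exists a', b.
  - intros t Ht. rewrite Hline by lra. symmetry. now apply straight_curve_scaled.
Qed.

(** Since [c T] is a positive multiple [k T0], a value [k >= 2] would make [gamma] the [k]-fold
    iterate of the straight curve of period [T0], with [phi t = c t]. *)
Lemma primitive_geodesic_direction (T : R) (gamma : R -> DoubleDelta) (m n : Z) (c T0 : R) :
  rel_prime m n -> Z.Odd n -> 0 < c -> 0 < T ->
  (Hex (lattice_point m n) /\ T0 = 1 \/ ~ Hex (lattice_point m n) /\ T0 = 3) ->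
  hex_vec (RtoC (c * T) * lattice_point m n)%C ->
  (forall t, 0 <= t <= T -> gamma t = straight_curve (lattice_point m n) (c * t)) ->
  ~ (exists (k : nat) (S : R) (delta : R -> DoubleDelta),
       (2 <= k)%nat /\ closed_geodesic S delta /\ iterate_of k S delta T gamma) ->
  c * T = T0.
Proof.
  intros Hmn Hodd Hc HT HT0 Hhex Hline Hprim.
  pose proof (proj1 (primitive_period m n (c * T) T0 Hmn HT0) Hhex) as [k Hk].
  assert (H0 : 0 < T0) by (destruct HT0 as [[_ ->] | [_ ->]]; lra).
  assert (Hkpos : (0 < k)%Z).
  { apply lt_IZR. apply (Rmult_lt_reg_r T0); [easy |]. rewrite <- Hk. nra. }
  destruct (Z.eq_dec k 1) as [-> | Hk1]; [lra |].
  exfalso. apply Hprim.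
  exists (Z.to_nat k), T0, (straight_curve (lattice_point m n)). split; [lia |]. split.
  - destruct (line_separated m n Hodd) as [rho Hrho].
    apply (line_closed_geodesic _ _ rho); auto using odd_lattice_point_neq_0.
    apply (primitive_period m n T0 T0 Hmn HT0). exists 1%Z. ring.
  - exists (fun t => c * t). split; [| split; [| split; [| split]]].
    + intros t. apply (ex_derive_continuous (fun t => c * t)). now auto_derive.
    + intros s t Hst. now apply Rmult_lt_compat_l.
    + ring.
    + rewrite Hk, INR_IZR_INZ, Z2Nat.id by lia. easy.
    + exact Hline.
Qed.

(** A proper iterate would yield a translation at some [t1] strictly between 0 and [T], hence
    [c t1 = j T0] with an integer [j] strictly between 0 and 1. *)
Lemma rescaled_line_primitive (T : R) (gamma : R -> DoubleDelta) (m n : Z) (T0 : R) :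
  rel_prime m n -> Z.Odd n -> smooth_closed_curve T gamma ->
  (Hex (lattice_point m n) /\ T0 = 1 \/ ~ Hex (lattice_point m n) /\ T0 = 3) ->
  rescaling_of T0 (straight_curve (lattice_point m n)) T gamma ->
  primitive_closed_geodesic T gamma /\ proportional_to_arc_length gamma.
Proof.
  intros Hmn Hodd [HT [Hper _]] HT0 [c [Hc [HcT Hline]]].
  set (w := lattice_point m n) in *. set (p := RtoC (1 / 2)).
  set (v := (RtoC c * w)%C).
  assert (Hscal : forall t, (RtoC t * v)%C = (RtoC (c * t) * w)%C).
  { intros t. unfold v. rewrite RtoC_mult. ring. }
  assert (Hv : v <> 0%C).
  { apply Cmult_neq_0; [intros H; apply RtoC_inj in H; lra |].
    now apply odd_lattice_point_neq_0. }
  assert (Hhex : hex_vec (RtoC T * v)%C).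
  { rewrite Hscal, HcT. apply (primitive_period m n T0 T0 Hmn HT0). exists 1%Z. ring. }
  destruct (line_separated m n Hodd) as [rho Hrho].
  assert (Hsep : forall t, separated rho (p + RtoC t * v)%C).
  { intros t. rewrite Hscal. apply Hrho. }
  pose proof (line_closed_geodesic p v rho T Hv Hsep HT Hhex) as Hgeo.
  assert (Hgamma : gamma = (fun t => proj (p + RtoC t * v)%C)).
  { apply functional_extensionality. apply (periodic_agree _ _ _ T HT Hper).
    - apply Hgeo.
    - intros t Ht. rewrite Hline by easy. now apply straight_curve_scaled. }
  rewrite Hgamma. split; [split; [easy |] | now apply (line_proportional _ _ rho)].
  intros [k [S [delta [Hk [[[HS [HperS _]] _] Hit]]]]].
  destruct (iterate_translation p v T S k delta Hv) as [t1 [Ht1 Hhex1]]; auto.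
  { intros t k' l'. now apply (separated_not_lattice rho). }
  rewrite Hscal in Hhex1.
  apply (primitive_period m n _ T0 Hmn HT0) in Hhex1. destruct Hhex1 as [j Hj].
  assert (H0 : 0 < T0) by (destruct HT0 as [[_ ->] | [_ ->]]; lra).
  assert (Hj0 : 0 < IZR j) by nra.
  assert (Hj1 : IZR j < 1) by nra.
  apply lt_IZR in Hj0, Hj1. lia.
Qed.

Theorem theorem5 (T : R) (gamma : R -> DoubleDelta)
  (hgamma : smooth_closed_curve T gamma)
  (hstart : gamma 0 = proj (RtoC (1 / 2)))
  (hvert : avoids_vertices gamma) :
  (primitive_closed_geodesic T gamma /\ proportional_to_arc_length gamma) <->
  (exists m n : Z, rel_prime m n /\ Z.Odd n /\
     (Hex (lattice_point m n) ->
        rescaling_of 1 (straight_curve (lattice_point m n)) T gamma) /\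
     (~ Hex (lattice_point m n) ->
        rescaling_of 3 (straight_curve (lattice_point m n)) T gamma)).
Proof.
  split.
  - intros [[[_ [_ [_ Hgeo]]] Hprim] Hprop].
    destruct (geodesic_is_rescaled_line T gamma hgamma hstart hvert Hgeo Hprop)
      as [m [n [c [Hmn [Hodd [Hc [Hhex Hline]]]]]]].
    destruct hgamma as [HT _].
    exists m, n. split; [easy |]. split; [easy |].
    split; intros H; exists c; (split; [easy |]; split; [| easy]);
      apply (primitive_geodesic_direction T gamma m n); auto.
  - intros [m [n [Hmn [Hodd [H1 H3]]]]].
    destruct (classic (Hex (lattice_point m n))) as [H | H].
    + apply (rescaled_line_primitive T gamma m n 1); auto.
    + apply (rescaled_line_primitive T gamma m n 3); auto.
Qed.
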